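(* Let $G$ be either a complete graph $K_n$ or a complete $k$-partite graph with $k\ge 2$, and assume $G$ is not isomorphic to $K_2$. Then ${\rm lir}(^2G)\le 2$.
   Context: For a graph $G$, $^2G$ denotes the multigraph obtained from $G$ by replacing every edge by two parallel edges. The degree of a vertex in a multigraph counts parallel edges with multiplicity. A multigraph is locally irregular if any two adjacent vertices have distinct degrees. A locally irregular edge coloring of a multigraph $M$ is an assignment of colors to the individual edges of $M$ (the two parallel copies of an edge may receive different colors) such that, for each color, the submultigraph formed by the edges of that color is locally irregular. ${\rm lir}(M)$ is the smallest number of colors in a locally irregular edge coloring of $M$. *)

(* Defs.v *)
From mathcomp Require Import all_boot.

Set Implicit Arguments.
Unset Strict Implicit.
Unset Printing Implicit Defensive.

Record sgraph := SGraph {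
  svertex :> finType;
  sadj : rel svertex;
  sadj_sym : symmetric sadj;
  sadj_irrefl : irreflexive sadj
}.

Definition isomorphic (G H : sgraph) : Prop :=
  exists f : G -> H,
    bijective f /\ forall x y : G, sadj (f x) (f y) = sadj x y.

Section CompleteGraph.
Variable n : nat.

Definition complete_adj : rel 'I_n := fun x y => x != y.

Lemma complete_adj_sym : symmetric complete_adj.
Proof. by move=> x y; rewrite /complete_adj eq_sym. Qed.

Lemma complete_adj_irrefl : irreflexive complete_adj.
Proof. by move=> x; rewrite /complete_adj eqxx. Qed.

Definition complete_graph : sgraph :=
  SGraph complete_adj_sym complete_adj_irrefl.
End CompleteGraph.

(* [part] sends a vertex to the index of its class; the surjectivity clause
   says that none of the k classes is empty. *)
Definition complete_multipartite (k : nat) (G : sgraph) : Prop :=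
  exists part : G -> 'I_k,
    (forall i : 'I_k, exists x : G, part x = i) /\
    (forall x y : G, sadj x y = (part x != part y)).

Definition sedges (G : sgraph) : {set {set G}} :=
  [set [set p.1; p.2] | p : G * G & sadj p.1 p.2].

(* Finite loopless multigraphs: edges are individual objects, and parallel
   edges are distinct edges with the same set of ends. *)
Record mgraph := MGraph {
  mvertex : finType;
  medge : finType;
  ends : medge -> {set mvertex};
  card_ends : forall e : medge, #|ends e| = 2
}.

Definition mdegree (M : mgraph) (v : mvertex M) : nat :=
  #|[set e : medge M | v \in ends e]|.

Definition madj (M : mgraph) : rel (mvertex M) :=
  fun u v => [exists e : medge M, ends e == [set u; v]].

Definition locally_irregular (M : mgraph) : Prop :=
  forall u v : mvertex M, madj u v -> mdegree u <> mdegree v.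

(* The submultigraph formed by the edges in A keeps all the vertices of M;
   the extra isolated vertices do not affect local irregularity. *)
Definition edge_submgraph (M : mgraph) (A : {set medge M}) : mgraph :=
  @MGraph (mvertex M) {e : medge M | e \in A} (fun e => ends (val e))
    (fun e => card_ends (val e)).

Definition locally_irregular_coloring (M : mgraph) (k : nat)
    (c : medge M -> 'I_k) : Prop :=
  forall i : 'I_k,
    locally_irregular (edge_submgraph [set e : medge M | c e == i]).

Definition locally_irregular_colorable (M : mgraph) (k : nat) : Prop :=
  exists c : medge M -> 'I_k, locally_irregular_coloring c.

(* [is_lir M k] states lir(M) = k. It is a relation because lir(M) is undefined
   when M has no locally irregular edge coloring at all. *)
Definition is_lir (M : mgraph) (k : nat) : Prop :=
  locally_irregular_colorable M k /\
  forall j : nat, locally_irregular_colorable M j -> k <= j.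

Section Doubling.
Variable G : sgraph.

Lemma card_sedge (e : {set G}) : e \in sedges G -> #|e| = 2.
Proof.
case/imsetP=> -[x y]; rewrite inE /= => xy ->; rewrite cards2.
by case: eqVneq xy => // ->; rewrite sadj_irrefl.
Qed.

(* The boolean component tells apart the two copies of an edge. *)
Definition doubling : mgraph :=
  @MGraph G ({e : {set G} | e \in sedges G} * bool)%type
    (fun e => val e.1) (fun e => card_sedge (valP e.1)).
End Doubling.

(* Main.v *)
(* Number the parts 0, 1, 2, ... by decreasing size and give both copies of an
   edge between parts i < j the same color, red iff j is odd.  Red (resp. blue)
   degrees are then strictly increasing along red (resp. blue) edges oriented
   towards the larger index, except possibly between parts 0 and 1, where they
   agree exactly when the two parts have the same size s.  To break this tie,
   recolor one copy of some edges: for s > 1, all edges from a fixed vertex of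
   part 0 to part 1; for s = 1, where all parts are singletons, the edge between
   parts 0 and 2, which only makes two degrees odd.  The one case without a
   part 2 is K_2. *)
Require Import Defs.
From mathcomp Require Import all_boot zify.
From Stdlib Require Classical_Prop.

Set Implicit Arguments.
Unset Strict Implicit.
Unset Printing Implicit Defensive.

(** * Two-colorings of the doubling as symmetric edge weights *)

Lemma mdegree_edge_submgraph (M : mgraph) (A : {set medge M}) (v : mvertex M) :
  mdegree (M := edge_submgraph A) v = #|[set e in A | v \in ends e]|.
Proof.
rewrite /mdegree -(card_imset _ val_inj); apply: eq_card => e.
rewrite inE; apply/imsetP/andP => [[e' /[!inE] ve' ->]|[eA ve]].
  by split=> //; apply: (valP e').
by exists (Sub e eA); rewrite ?inE.
Qed.

Lemma card_incident_doubling (G : sgraph) (P : G -> G -> bool -> bool)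
    (A : {set medge (doubling G)}) (v : G) :
  (forall (e : medge (doubling G)) (x y : G),
     val e.1 = [set x; y] -> (e \in A) = P x y e.2) ->
  #|[set e in A | v \in ends e]| =
    \sum_(y | sadj v y) \sum_(b : bool) P v y b.
Proof.
move=> AP.
transitivity #|[set p : G * bool | sadj v p.1 && P v p.1 p.2]|; last first.
  rewrite -sum1_card pair_big_dep /= big_mkcond [RHS]big_mkcond /=.
  by apply: eq_bigr => -[y b] _; rewrite inE /= andbT; case: sadj; case: (P v y b).
(* Edges at [v] and pairs (neighbor, copy) live in different types; both embed into
   [{set G} * bool], where their images coincide. *)
pose g (e : medge (doubling G)) : {set G} * bool := (val e.1, e.2).
pose h (p : G * bool) : {set G} * bool := ([set v; p.1], p.2).
have g_inj : injective g by move=> [e b] [e' b'] [] /val_inj -> ->.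
have h_inj : {in [set p : G * bool | sadj v p.1 && P v p.1 p.2] &, injective h}.
  move=> [y b] [y' b'] /[!inE] /andP[/= vy _] /andP[vy' _] [/setP E ->].
  congr pair; have := E y; rewrite !inE eqxx orbT => /esym /orP[/eqP yv|/eqP//].
  by move: vy; rewrite yv sadj_irrefl.
rewrite -(card_imset _ g_inj) -(card_in_imset h_inj); apply: eq_card => -[a b].
apply/imsetP/imsetP => [[[e b'] /[!inE] /andP[eA ve] [-> ->]]|].
  have [[x y] /[!inE] /= xy exy] := imsetP (valP e).
  have [vx|vy] : v = x \/ v = y.
    by move: ve; rewrite /= exy !inE => /orP[]/eqP; [left | right].
  - exists (y, b'); last by rewrite /h vx -exy.
    by rewrite inE /= {1}vx xy -(AP (e, b')) //= exy vx.
  - exists (x, b'); last by rewrite /h vy setUC -exy.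
    by rewrite inE /= {1}vy sadj_sym xy -(AP (e, b')) //= exy vy setUC.
move=> [[y b'] /[!inE] /= /andP[vy Pvy] [-> ->]].
have eE : [set v; y] \in sedges G by apply/imsetP; exists (v, y); rewrite ?inE.
exists (Sub [set v; y] eE, b') => //.
by rewrite inE (AP _ v y) //= Pvy !inE eqxx.
Qed.

(* [w x y] is the number of red copies of the edge xy. *)
Lemma weight_colorable (G : sgraph) (w : G -> G -> nat) :
  (forall x y, w x y = w y x) ->
  (forall x y, w x y <= 2) ->
  (forall x y, sadj x y -> 0 < w x y ->
     \sum_(z | sadj x z) w x z <> \sum_(z | sadj y z) w y z) ->
  (forall x y, sadj x y -> w x y < 2 ->
     \sum_(z | sadj x z) (2 - w x z) <> \sum_(z | sadj y z) (2 - w y z)) ->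
  locally_irregular_colorable (doubling G) 2.
Proof.
move=> w_sym w_le2 w_red w_blue.
(* With [false] and [true] read as 0 and 1, exactly [w x y] of the two copies satisfy [b < w x y].
   Color [ord0] is red. *)
pose P (i : 'I_2) x y (b : bool) := (b < w x y) == (i == ord0).
(* An edge is an unordered pair, so its ends are quantified; symmetry of [w] makes their order
   irrelevant. *)
pose red (e : medge (doubling G)) :=
  [exists x in val e.1, exists y in val e.1, sadj x y && (e.2 < w x y)].
have redE (e : medge (doubling G)) x y : val e.1 = [set x; y] ->
    red e = (e.2 < w x y).
  move=> exy; rewrite /red exy.
  have xy : sadj x y.
    have [[x' y'] /[!inE] /= xy' e'] := imsetP (valP e.1).
    have := e'; rewrite exy => /setP E.
    have := E x'; have := E y'; have := E x; have := E y; rewrite !inE !eqxx !orbT.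
    case/esym/orP=> /eqP yE; case/esym/orP=> /eqP xE; subst => //.
    - by move=> /orP[]/eqP yx; move: xy'; rewrite yx sadj_irrefl.
    - by move=> _ _; rewrite sadj_sym.
    - by move=> _ /orP[]/eqP yx; move: xy'; rewrite yx sadj_irrefl.
  apply/existsP/idP => [[a /andP[ae /existsP[b /andP[be /andP[ab]]]]]|lt_w].
    move: ae be; rewrite !inE => /orP[]/eqP aE /orP[]/eqP bE; move: ab;
      by rewrite aE bE ?sadj_irrefl // w_sym.
  by exists x; rewrite !inE eqxx; apply/existsP; exists y; rewrite !inE eqxx orbT xy.
pose c (e : medge (doubling G)) : 'I_2 := if red e then ord0 else ord_max.
have cE i e x y : val e.1 = [set x; y] ->
    (e \in [set e | c e == i]) = P i x y e.2.
  move=> exy; rewrite inE /c /P -(redE _ _ _ exy).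
  by case: (red e); case: i => -[|[]].
have degE i v : mdegree (M := edge_submgraph [set e | c e == i]) v =
    \sum_(y | sadj v y) (if i == ord0 then w v y else 2 - w v y).
  rewrite mdegree_edge_submgraph (@card_incident_doubling _ (P i)); last exact: cE.
  apply: eq_bigr => y _; rewrite /P big_bool; have := w_le2 v y.
  by case: (i == ord0); case: (w v y) => [|[|[]]].
exists c => i u v /existsP[[e eA] /= /eqP euv].
have uv : sadj u v.
  have := card_ends e; rewrite /= euv cards2 => uv.
  have [[x y] /[!inE] /= xy exy] := imsetP (valP e.1).
  move/setP: (etrans (esym euv) exy) => E.
  have := E u; have := E v; rewrite !inE !eqxx orbT /=.
  move=> /esym/orP[]/eqP vE /esym/orP[]/eqP uE; subst=> //.
  - by rewrite eqxx in uv.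
  - by rewrite sadj_sym.
  - by rewrite eqxx in uv.
rewrite !degE; move: eA; rewrite (cE i e u v) // /P.
have [_|_] := eqVneq i ord0; rewrite ?eqbF_neg ?eqb_id => lt_w.
  by apply: w_red => //; lia.
by apply: w_blue => //; case: (e.2) lt_w; lia.
Qed.

Lemma rank_weight_colorable (G : sgraph) (q : G -> nat) (w : G -> G -> nat) :
  (forall x y, sadj x y = (q x != q y)) ->
  (forall x y, w x y = w y x) ->
  (forall x y, w x y <= 2) ->
  (forall x y, q x < q y -> 0 < w x y ->
     \sum_(z | q z != q x) w x z <> \sum_(z | q z != q y) w y z) ->
  (forall x y, q x < q y -> w x y < 2 ->
     \sum_(z | q z != q x) (2 - w x z) <> \sum_(z | q z != q y) (2 - w y z)) ->
  locally_irregular_colorable (doubling G) 2.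
Proof.
move=> adjE w_sym w_le2 w_red w_blue.
have sumE (f : G -> nat) x : \sum_(z | sadj x z) f z = \sum_(z | q z != q x) f z.
  by apply: eq_bigl => z; rewrite adjE eq_sym.
apply: (@weight_colorable G w) => // x y; rewrite adjE !sumE neq_ltn.
  case/orP=> [lt_q|lt_q]; first exact: w_red.
  by rewrite w_sym => wyx /esym; apply: w_red.
case/orP=> [lt_q|lt_q]; first exact: w_blue.
by rewrite w_sym => wyx /esym; apply: w_blue.
Qed.

(** * Class sizes and degrees within one color *)

(** A sum of indicators, like [color_degree], so that relations between the two can be checked
    vertex by vertex. *)
Definition class_size (T : finType) (q : T -> nat) (i : nat) : nat :=
  \sum_z (q z == i).

(* The degree, in the simple graph whose edges between classes i <> j are those
   with [c (maxn i j)], of a vertex of class i. *)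
Definition color_degree (T : finType) (q : T -> nat) (c : pred nat) (i : nat) :
    nat :=
  \sum_z ((q z != i) && c (maxn (q z) i)).

Lemma class_size_gt0 (T : finType) (q : T -> nat) (x : T) :
  0 < class_size q (q x).
Proof. by rewrite /class_size (bigD1 x) //= eqxx. Qed.

Lemma class_size_gt0P (T : finType) (q : T -> nat) (i : nat) :
  0 < class_size q i -> exists x, q x = i.
Proof.
rewrite lt0n sum_nat_eq0 negb_forall => /existsP[x]; rewrite /= eqb0 negbK.
by move/eqP; exists x.
Qed.

Lemma class_size1_inj (T : finType) (q : T -> nat) :
  (forall i, class_size q i <= 1) -> injective q.
Proof.
move=> s_le1 x y qxy; have := s_le1 (q x).
rewrite /class_size (bigD1 x) //= eqxx; case: (eqVneq x y) => // xy.
by rewrite (bigD1 y) /= ?qxy ?eqxx // eq_sym.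
Qed.

(** Each side counts the vertices in a class or joined to it. For [j] this includes every vertex of
    rank at most [j], because [c j] holds; vertices of larger rank are joined to both classes or to
    neither. *)
Lemma color_degree_le (T : finType) (q : T -> nat) (c : pred nat) (i j : nat) :
  i < j -> c j ->
  color_degree q c i + class_size q i <= color_degree q c j + class_size q j.
Proof.
move=> ij cj; rewrite /color_degree /class_size -!big_split /=.
apply: leq_sum => z _.
case: (ltngtP (q z) j) => [zj|zj|zj].
- by rewrite cj; case: (q z == i); case: (c (maxn (q z) i)).
- rewrite (_ : maxn (q z) i = q z); last by lia.
  by rewrite (_ : q z == i = false) ?addn0 //; lia.
- by case: (q z == i); case: (c (maxn (q z) i)); case: (c _).
Qed.

(* The hypotheses say that class l is joined to class j but not to class i. *)
Lemma color_degree_gap (T : finType) (q : T -> nat) (c : pred nat) (i j l : nat) :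
  i < j -> c j -> l < j -> l != i -> ~~ c (maxn l i) ->
  color_degree q c i + class_size q i + class_size q l <=
    color_degree q c j + class_size q j.
Proof.
move=> ij cj lj li ncl; rewrite /color_degree /class_size -!big_split /=.
apply: leq_sum => z _.
have [zl|zl] := eqVneq (q z) l.
  by rewrite zl (negbTE li) (negbTE ncl) (maxn_idPr (ltnW lj)) cj; lia.
case: (ltngtP (q z) j) => [zj|zj|zj].
- by rewrite cj; case: (q z == i); case: (c (maxn (q z) i)).
- rewrite (_ : maxn (q z) i = q z); last by lia.
  by rewrite (_ : q z == i = false) ?addn0 //; lia.
- by case: (q z == i); case: (c (maxn (q z) i)); case: (c _).
Qed.

(** Since colors alternate, the class l = j - 1 is joined to [j] but not to [i]; if i = j - 1, class
    0 serves instead, and [1 < j] keeps it distinct from [i]. As sizes decrease, the extra term in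
    [color_degree_gap] is at least the positive size of class [j]. *)
Lemma color_degree_lt (T : finType) (q : T -> nat) (c : pred nat) (i j : nat) :
  (forall i j, i <= j -> class_size q j <= class_size q i) ->
  (forall n, c n.+1 = ~~ c n) ->
  i < j -> 1 < j -> c j -> 0 < class_size q j ->
  color_degree q c i < color_degree q c j.
Proof.
move=> s_mono c_alt ij j1 cj sj.
have ncj1 : ~~ c j.-1 by rewrite -(c_alt j.-1) prednK //; lia.
have [l [lj li ncl]] : exists l, [/\ l < j, l != i & ~~ c (maxn l i)].
  have [ji|ji] := eqVneq j i.+1.
    by exists 0; rewrite max0n; move: ncj1; rewrite ji; split=> //; lia.
  by exists j.-1; rewrite (_ : maxn j.-1 i = j.-1); [split=> //|]; lia.
have := color_degree_gap q ij cj lj li ncl.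
have := s_mono i j (ltnW ij); have := s_mono l j (ltnW lj); lia.
Qed.

Lemma sum_odd_weight (T : finType) (q : T -> nat) (i : nat) :
  \sum_(z | q z != i) (if odd (maxn (q z) i) then 2 else 0) =
    2 * color_degree q odd i.
Proof.
rewrite /color_degree big_distrr big_mkcond /=; apply: eq_bigr => z _.
by case: (q z != i) => //=; case: odd.
Qed.

Lemma sum_even_weight (T : finType) (q : T -> nat) (i : nat) :
  \sum_(z | q z != i) (2 - (if odd (maxn (q z) i) then 2 else 0)) =
    2 * color_degree q (negb \o odd) i.
Proof.
rewrite /color_degree big_distrr big_mkcond /=; apply: eq_bigr => z _.
by case: (q z != i) => //=; case: odd.
Qed.

(** Each class from 2 on is joined to both of the classes 0 and 1 or to neither, so only the edges
    between these two can separate their degrees. *)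
Lemma color_degree01_joined (T : finType) (q : T -> nat) (c : pred nat) : c 1 ->
  color_degree q c 0 + class_size q 0 = color_degree q c 1 + class_size q 1.
Proof.
move=> c1; rewrite /color_degree /class_size -!big_split /=.
apply: eq_bigr => z _; case: (q z) => [|[|n]] //=; rewrite ?c1 //.
Qed.

Lemma color_degree01_unjoined (T : finType) (q : T -> nat) (c : pred nat) :
  ~~ c 1 -> color_degree q c 0 = color_degree q c 1.
Proof.
move=> /negbTE c1; rewrite /color_degree.
by apply: eq_bigr => z _; case: (q z) => [|[|n]] //=; rewrite ?c1.
Qed.

Lemma color_degreeC (T : finType) (q : T -> nat) (c : pred nat) (i : nat) :
  color_degree q c i + color_degree q (negb \o c) i + class_size q i = #|T|.
Proof.
rewrite /color_degree /class_size -!big_split /= -sum1_card.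
by apply: eq_bigr => z _; case: (q z == i) => //=; case: (c _).
Qed.

(** * The colorings, according to the sizes of the two largest classes *)

(** The untouched coloring works: between classes 0 and 1 the drop in size makes [color_degree_le]
    strict, and every other edge falls under [color_degree_lt]. *)
Lemma colorable_distinct_top (G : sgraph) (q : G -> nat) :
  (forall x y, sadj x y = (q x != q y)) ->
  (forall i j, i <= j -> class_size q j <= class_size q i) ->
  class_size q 1 < class_size q 0 ->
  locally_irregular_colorable (doubling G) 2.
Proof.
move=> adjE s_mono s10.
pose w x y := if odd (maxn (q y) (q x)) then 2 else 0.
apply: (rank_weight_colorable (w := w) adjE) => [x y|x y|x y ij|x y ij];
  rewrite /w.
- by rewrite maxnC.
- by case: odd.
- rewrite (maxn_idPl (ltnW ij)) !sum_odd_weight; case: ifP => // jodd _.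
  have [j1|j1] := leqP (q y) 1.
    have [xi yj] : q x = 0 /\ q y = 1 by lia.
    by have := @color_degree_le _ q odd 0 1 isT isT; rewrite xi yj; lia.
  by have := color_degree_lt s_mono _ ij j1 jodd (class_size_gt0 q y);
    move=> /(_ (fun=> erefl)); lia.
- rewrite (maxn_idPl (ltnW ij)) !sum_even_weight; case: ifP => // jeven _.
  have j1 : 1 < q y by lia.
  by have := @color_degree_lt _ q (negb \o odd) _ _ s_mono _ ij j1 _
       (class_size_gt0 q y);
    move=> /(_ (fun=> erefl) (negbT jeven)); lia.
Qed.

Lemma colorable_equal_top (G : sgraph) (q : G -> nat) :
  (forall x y, sadj x y = (q x != q y)) ->
  (forall i j, i <= j -> class_size q j <= class_size q i) ->
  class_size q 1 = class_size q 0 -> 1 < class_size q 0 ->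
  locally_irregular_colorable (doubling G) 2.
Proof.
move=> adjE s_mono s10 s0.
have [x0 qx0] : exists x, q x = 0 by apply: class_size_gt0P; lia.
pose w0 x y := if odd (maxn (q y) (q x)) then 2 else 0.
(* The number of copies turned from red to blue. Both copies of these edges were red, as 1 is
   odd. *)
pose m x y := (x == x0) && (q y == 1) || (y == x0) && (q x == 1).
pose w x y := w0 x y - m x y.
have m_le x y : m x y <= w0 x y.
  rewrite /m /w0; case: eqVneq => [->|_] /=.
    by rewrite qx0 maxn0; case: eqVneq => [->|_] //; rewrite andbF.
  by case: eqVneq => [->|_] //=; rewrite qx0 max0n; case: eqVneq => [->|].
have w0_le x y : w0 x y <= 2 by rewrite /w0; case: odd.
have sum_m x : \sum_(z | q z != q x) m x z =
    if x == x0 then class_size q 1 else q x == 1.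
  case: eqVneq => [->|xx0].
    rewrite qx0 /class_size big_mkcond; apply: eq_bigr => z _.
    by rewrite /m eqxx qx0 andbF orbF; case: (q z) => [|[]].
  rewrite big_mkcond (bigD1 x0) //= big1 => [|z zx0]; last first.
    by rewrite /m (negbTE xx0) (negbTE zx0); case: ifP.
  by rewrite /m (negbTE xx0) eqxx qx0; case: (q x) => [|[]].
have red_sum x : \sum_(z | q z != q x) w x z +
    (if x == x0 then class_size q 1 else q x == 1) = 2 * color_degree q odd (q x).
  rewrite -sum_m -sum_odd_weight -big_split /=; apply: eq_bigr => z _.
  by rewrite /w -/(w0 x z) subnK.
have blue_sum x : \sum_(z | q z != q x) (2 - w x z) =
    2 * color_degree q (negb \o odd) (q x) +
    if x == x0 then class_size q 1 else q x == 1.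
  rewrite -sum_m -sum_even_weight -big_split /=; apply: eq_bigr => z _.
  by rewrite /w -/(w0 x z); have := m_le x z; have := w0_le x z; lia.
apply: (rank_weight_colorable (w := w) adjE) => [x y|x y|x y ij wxy|x y ij wxy].
- by rewrite /w /w0 /m maxnC orbC.
- by rewrite /w; have := w0_le x y; lia.
- have jodd : odd (q y).
    by move: wxy; rewrite /w /w0 (maxn_idPl (ltnW ij)); case: ifP.
  have yx0 : y != x0 by apply: contraTneq ij => ->; rewrite qx0.
  have := red_sum x; have := red_sum y; rewrite (negbTE yx0).
  have [j1|j1] := leqP (q y) 1.
    have [xi yj] : q x = 0 /\ q y = 1 by lia.
    (* The unmodified red degrees agree. The end in class 1 loses 1, while the end in class 0 loses
       [class_size q 1], which exceeds 1, if it is [x0], and nothing otherwise. *)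
    have := @color_degree01_joined _ q odd isT.
    by rewrite xi yj; case: (x == x0) => /=; lia.
  have := color_degree_lt s_mono (fun=> erefl) ij j1 jodd (class_size_gt0 q y).
  case: eqVneq => [->|_]; first by lia.
  by case: (eqVneq (q x) 1); lia.
- have yx0 : y != x0 by apply: contraTneq ij => ->; rewrite qx0.
  rewrite !blue_sum (negbTE yx0).
  have [j1|j1] := leqP (q y) 1.
    have [xi yj] : q x = 0 /\ q y = 1 by lia.
    have := @color_degree01_unjoined _ q (negb \o odd) isT.
    by rewrite xi yj; case: (x == x0) => /=; lia.
  have yj1 : q y == 1 = false by lia.
  have jeven : ~~ odd (q y).
    move: wxy; rewrite /w /w0 /m (maxn_idPl (ltnW ij)) (negbTE yx0) yj1 andbF.
    by case: odd.
  (* The blue degree of [x0] grew by the size of class 1. That class is joined in blue to class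
     [q y] but not to class 0, so the gap, counted twice, exceeds the growth. *)
  rewrite yj1; case: (eqVneq x x0) ij => [-> ij|_ ij].
    rewrite qx0 in ij *.
    have := @color_degree_gap _ q (negb \o odd) 0 (q y) 1 ij jeven j1 isT isT.
    by have := s_mono 0 (q y) isT; lia.
  have := color_degree_lt (c := negb \o odd) s_mono (fun=> erefl) ij j1 jeven
     (class_size_gt0 q y).
  by case: (eqVneq (q x) 1); lia.
Qed.

(** All classes are singletons. The edge [x0 z0] is blue because 2 is even; turning one copy red
    makes both color degrees odd at these two vertices and leaves all others even. *)
Lemma colorable_complete (G : sgraph) (q : G -> nat) :
  (forall x y, sadj x y = (q x != q y)) ->
  (forall i j, i <= j -> class_size q j <= class_size q i) ->
  class_size q 0 = 1 -> 0 < class_size q 2 ->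
  locally_irregular_colorable (doubling G) 2.
Proof.
move=> adjE s_mono s0 s2.
have s_le1 i : class_size q i <= 1 by rewrite -s0 s_mono.
have q_inj := class_size1_inj s_le1.
have [x0 qx0] : exists x, q x = 0 by apply: class_size_gt0P; lia.
have [z0 qz0] := class_size_gt0P s2.
have z0x0 : z0 != x0 by apply: contra_eq_neq qz0 => ->; rewrite qx0.
pose w0 x y := if odd (maxn (q y) (q x)) then 2 else 0.
pose m x y := (x == x0) && (y == z0) || (x == z0) && (y == x0).
pose w x y := w0 x y + m x y.
have m_le x y : w0 x y + m x y <= 2.
  rewrite /m /w0 -!(inj_eq q_inj) qx0 qz0.
  by case: (q x) => [|[|[|i]]]; case: (q y) => [|[|[|j]]] //=; case: odd.
have sum_m x : \sum_(z | q z != q x) m x z = (x == x0) || (x == z0).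
  case: (eqVneq x x0) => [->|xx0] /=.
    rewrite (bigD1 z0) /= ?qz0 ?qx0 // big1 => [|z /andP[_ zz0]].
      by rewrite /m !eqxx.
    by rewrite /m (negbTE zz0) andbF eq_sym (negbTE z0x0).
  case: (eqVneq x z0) => [->|xz0].
    rewrite (bigD1 x0) /= ?qz0 ?qx0 // big1 => [|z /andP[_ zx0]].
      by rewrite /m !eqxx orbT.
    by rewrite /m (negbTE zx0) andbF (negbTE z0x0).
  by rewrite big1 // => z _; rewrite /m (negbTE xx0) (negbTE xz0).
have red_sum x : \sum_(z | q z != q x) w x z =
    2 * color_degree q odd (q x) + ((x == x0) || (x == z0)).
  by rewrite -sum_m -sum_odd_weight -big_split.
have blue_sum x : \sum_(z | q z != q x) (2 - w x z) +
    ((x == x0) || (x == z0)) = 2 * color_degree q (negb \o odd) (q x).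
  rewrite -sum_m -sum_even_weight -big_split /=; apply: eq_bigr => z _.
  by rewrite /w -/(w0 x z); have := m_le x z; lia.
(* The blue degrees differ by [color_degree_lt]; with equal class sizes the red and blue degrees
   have the same sum at both vertices, so the red ones differ too. *)
have deg02 : color_degree q odd 0 <> color_degree q odd 2.
  have := color_degreeC q odd 0; have := color_degreeC q odd 2.
  have := @color_degree_lt _ q (negb \o odd) 0 2 s_mono (fun=> erefl) isT isT isT s2.
  by have := s_mono 0 2 isT; lia.
have deg02' : color_degree q (negb \o odd) 0 <> color_degree q (negb \o odd) 2.
  have := color_degreeC q odd 0; have := color_degreeC q odd 2.
  by have := s_mono 0 2 isT; lia.
(* Either the edge is the modified one, or exactly one end is modified and parity separates the
   degrees, or neither is. In the last case both ranks avoid 0 and 2, so the larger is at least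
   3. *)
have pairP x y : q x < q y -> [\/ x = x0 /\ y = z0,
    ((x == x0) || (x == z0)) != ((y == x0) || (y == z0)) |
    [/\ (x == x0) || (x == z0) = false, (y == x0) || (y == z0) = false,
       m x y = false & 1 < q y]].
  rewrite /m -!(inj_eq q_inj) qx0 qz0 => ij.
  have [i0|i0] := eqVneq (q x) 0; have [j2|j2] := eqVneq (q y) 2.
  - by constructor 1; split; apply: q_inj; rewrite ?i0 ?j2.
  - by constructor 2; lia.
  - by constructor 2; lia.
  - have [i2|i2] := eqVneq (q x) 2; first by constructor 2; lia.
    by constructor 3; split; lia.
apply: (rank_weight_colorable (w := w) adjE) => [x y|x y|x y ij wxy|x y ij wxy].
- by rewrite /w /w0 /m maxnC orbC andbC [X in _ || X]andbC.
- exact: m_le.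
- rewrite !red_sum.
  case: (pairP x y ij) => [[-> ->]|tweak|[-> -> mxy j1]].
  + by rewrite qx0 qz0 !eqxx orbT; lia.
  + by move: tweak; case: (_ || _); case: (_ || _) => // _; lia.
  have jodd : odd (q y).
    by move: wxy; rewrite /w /w0 mxy (maxn_idPl (ltnW ij)); case: odd.
  by have := color_degree_lt s_mono (fun=> erefl) ij j1 jodd (class_size_gt0 q y); lia.
- have := blue_sum x; have := blue_sum y.
  case: (pairP x y ij) => [[-> ->]|tweak|[-> -> mxy j1]].
  + by rewrite qx0 qz0 !eqxx orbT; lia.
  + by move: tweak; case: (_ || _); case: (_ || _) => // _; lia.
  have jeven : ~~ odd (q y).
    by move: wxy; rewrite /w /w0 mxy (maxn_idPl (ltnW ij)); case: odd.
  by have := color_degree_lt (c := negb \o odd) s_mono (fun=> erefl) ij j1 jeven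
     (class_size_gt0 q y); lia.
Qed.

(** * Ranking the parts by size, and the conclusion *)

(** The rank of a vertex is the position of its part in the list of parts sorted by decreasing size;
    ranks beyond the list have size 0. *)
Lemma sorted_rank (G : finType) (k : nat) (part : G -> 'I_k) :
  exists q : G -> nat, (forall x y, (q x == q y) = (part x == part y)) /\
    forall i j, i <= j -> class_size q j <= class_size q i.
Proof.
pose s (a : 'I_k) := class_size (fun x => part x : nat) a.
pose ge_s (a b : 'I_k) := s b <= s a.
have ge_s_trans : transitive ge_s by move=> b a c /[swap]; apply: leq_trans.
have ge_s_refl : reflexive ge_s by move=> a; apply: leqnn.
pose t := sort ge_s (enum 'I_k).
have t_sorted : sorted ge_s t.
  by apply: sort_sorted => a b; apply: leq_total.
have in_t a : a \in t by rewrite mem_sort mem_enum.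
pose q x := index (part x) t.
have qE x y : (q x == q y) = (part x == part y).
  by rewrite /q; apply/eqP/eqP => [|->//]; apply: (index_inj (part x)).
have sizeE x : class_size q (q x) = s (part x).
  by apply: eq_bigr => z _; rewrite qE.
exists q; split=> // i j ij.
have [->//|/class_size_gt0P[y qy]] := posnP (class_size q j).
have jt : j < size t by rewrite -qy index_mem.
have it : i < size t by apply: leq_ltn_trans jt.
pose a := nth (part y) t i.
(* No vertex of rank [i] is at hand yet, so [sizeE] does not apply and the part is read off the
   sorted list. *)
have -> : class_size q i = s a.
  have t_uniq : uniq t by rewrite sort_uniq enum_uniq.
  apply: eq_bigr => z _; rewrite (inj_eq val_inj); congr nat_of_bool.
  by rewrite /a; apply/eqP/eqP => [<-|za]; rewrite ?nth_index // /q za index_uniq.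
rewrite -qy sizeE (_ : part y = nth (part y) t j); last first.
  by rewrite -qy nth_index.
exact: (sorted_leq_nth ge_s_trans ge_s_refl).
Qed.

Lemma isomorphic_K2 (G : sgraph) (q : G -> nat) :
  (forall x y, sadj x y = (q x != q y)) -> injective q ->
  0 < class_size q 0 -> 0 < class_size q 1 -> class_size q 2 = 0 ->
  (forall i j, i <= j -> class_size q j <= class_size q i) ->
  isomorphic G (complete_graph 2).
Proof.
move=> adjE q_inj /class_size_gt0P[x0 qx0] /class_size_gt0P[x1 qx1] s2 s_mono.
have q_lt2 x : q x < 2.
  rewrite ltnNge; apply/negP => /s_mono; rewrite s2.
  by rewrite leqNgt class_size_gt0.
pose f x : 'I_2 := Ordinal (q_lt2 x).
exists f; split=> [|x y]; last by rewrite adjE.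
exists (fun i : 'I_2 => if i == ord0 then x0 else x1) => [x|[[|[]] // i2]].
- apply: q_inj; rewrite -(inj_eq val_inj) /= /f.
  by have := q_lt2 x; case: (q x) => [|[]].
- by apply: val_inj; rewrite /= qx0.
- by apply: val_inj; rewrite /= qx1.
Qed.

Lemma multipartite_colorable (G : sgraph) (k : nat) (part : G -> 'I_k) :
  (forall x y, sadj x y = (part x != part y)) ->
  ~ isomorphic G (complete_graph 2) ->
  locally_irregular_colorable (doubling G) 2.
Proof.
move=> adjE notK2; have [q [qE s_mono]] := sorted_rank part.
have {}adjE x y : sadj x y = (q x != q y) by rewrite adjE qE.
have := s_mono 0 1 isT; rewrite leq_eqVlt => /orP[/eqP s10|]; last first.
  exact: colorable_distinct_top.
have [s0|s0] := leqP (class_size q 0) 1; last exact: colorable_equal_top s0.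
(* Class 0 is the largest, so if it is empty then [G] has no vertices. *)
have [s0'|s0'] := posnP (class_size q 0).
  have noG (x : G) : False.
    by have := s_mono 0 (q x) isT; rewrite s0' leqNgt class_size_gt0.
  by apply: (@weight_colorable G (fun _ _ => 0)) => // x; case: (noG x).
have {}s0 : class_size q 0 = 1 by lia.
have [s2|s2] := posnP (class_size q 2); last exact: colorable_complete s2.
case: notK2; apply: (isomorphic_K2 adjE) => //; last by rewrite s10.
by apply: class_size1_inj => i; rewrite -s0 s_mono.
Qed.

Theorem theorem3 (G : sgraph) :
  (exists n : nat, isomorphic G (complete_graph n)) \/
  (exists k : nat, 2 <= k /\ complete_multipartite k G) ->
  ~ isomorphic G (complete_graph 2) ->
  exists l : nat, is_lir (doubling G) l /\ l <= 2.
Proof.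
move=> G_complete notK2.
have [k [part adjE]] : exists k (part : G -> 'I_k),
    forall x y, sadj x y = (part x != part y).
  case: G_complete => [[n [f [_ fE]]]|[k [_ [part [_ partE]]]]].
    (* The isomorphism to the complete graph is itself a partition into singletons. *)
    by exists n, f => x y; rewrite -fE.
  by exists k, part.
have col2 := multipartite_colorable adjE notK2.
(* An exact minimum is required, so it is decided classically whether 0 or 1 colors already
   suffice. *)
have [col0|ncol0] := Classical_Prop.classic
  (locally_irregular_colorable (doubling G) 0); first by exists 0.
have [col1|ncol1] := Classical_Prop.classic
  (locally_irregular_colorable (doubling G) 1).
  by exists 1; split=> //; split=> // -[].
by exists 2; split=> //; split=> // -[|[]].
Qed.
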